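(* Let $n,m$ be positive integers and let $A\ge 2$ be an integer. Let $\zeta_n=e^{2\pi\sqrt{-1}/n}$ and for positive integers $s_1,\dots,s_m$ put $$\mathfrak Z_n(\zeta_n;;s_1,\dots,s_m)=\sum_{1\le i_1<\dots<i_m\le n-1}\prod_{k=1}^m\frac{1}{(1-\zeta_n^{i_k})^{s_k}}.$$ Write $\mathfrak Z_n(\zeta_n;;1^{j-1},A,1^{m-j})$ for this sum with $s_j=A$ and $s_i=1$ for $i\ne j$. Then \begin{align*} \sum_{j=1}^{m}\mathfrak Z_n(\zeta_n;;1^{j-1},A,1^{m-j}) &=\sum_{k=0}^{A-3}\sum_{j=1}^{A-k-1}\frac{(-1)^{k+1}n^j\beta_j(n^{-1})}{(m+k+1)\,j!}\binom{n-1}{m+k}\binom{A-k-2}{j-1}\\ &\quad+(-1)^{A+1}\frac{(m+A-2)(n-2 m-2 A+1)}{2(m+A-1)(m+A)}\binom{n-1}{m+A-2}. \end{align*}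
   Context: The degenerate Bernoulli numbers $\beta_k(\lambda)$ (Carlitz) are defined by $\dfrac{t}{(1+\lambda t)^{1/\lambda}-1}=\sum_{k=0}^\infty\beta_k(\lambda)\dfrac{t^k}{k!}$. Binomial coefficients $\binom{a}{b}$ vanish for $b>a$ or $b<0$; empty sums are $0$. *)

(* Defs.v *)
From mathcomp Require Import all_boot all_order all_algebra.
From mathcomp Require Import all_classical all_reals all_analysis.
From mathcomp Require Import complex.

Set Implicit Arguments.
Unset Strict Implicit.
Unset Printing Implicit Defensive.

Import Order.TTheory GRing.Theory Num.Theory.
Local Open Scope ring_scope.

(* A formal power series is represented by its coefficient sequence. *)
Section FormalPowerSeries.
Variable F : numFieldType.
Implicit Types a b : nat -> F.

Definition fps_mul a b (n : nat) : F := \sum_(i < n.+1) a i * b (n - i)%N.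

(* Junk unless a 0 != 0. *)
Fixpoint fps_inv_seq a (n : nat) : seq F :=
  if n is n'.+1 then
    let s := fps_inv_seq a n' in
    rcons s (((n' == 0)%:R - \sum_(i < n') a (n' - i)%N * s`_i) / a 0)
  else [::].

Definition fps_inv a (n : nat) : F := (fps_inv_seq a n.+1)`_n.

Definition gbinom (x : F) (k : nat) : F :=
  (\prod_(i < k) (x - i%:R)) / k`!%:R.

(* (1 + l t)^(1/l), by the binomial series; meaningful for l != 0 only. *)
Definition degexp (l : F) (k : nat) : F := gbinom l^-1 k * l ^+ k.

(* t / ((1 + l t)^(1/l) - 1) is computed as the inverse of                    *)
(* ((1 + l t)^(1/l) - 1) / t; the defining generating function identity is    *)
(* degBernoulli_genfun below.                                                 *)
Definition degBernoulli (k : nat) (l : F) : F :=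
  k`!%:R * fps_inv (fun i => degexp l i.+1) k.

Lemma size_fps_inv_seq a n : size (fps_inv_seq a n) = n.
Proof. by elim: n => //= n IHn; rewrite size_rcons IHn. Qed.

Lemma nth_fps_inv_seq a n i : (i < n)%N -> (fps_inv_seq a n)`_i = fps_inv a i.
Proof.
elim: n => // n IHn; rewrite ltnS leq_eqVlt => /predU1P[->//|lt_in] /=.
by rewrite nth_rcons size_fps_inv_seq lt_in IHn.
Qed.

Lemma fps_invE a n :
  fps_inv a n = ((n == 0)%:R - \sum_(i < n) a (n - i)%N * fps_inv a i) / a 0.
Proof.
rewrite {1}/fps_inv /= nth_rcons size_fps_inv_seq ltnn eqxx.
by congr ((_ - _) / _); apply: eq_bigr => i _; rewrite nth_fps_inv_seq.
Qed.

Lemma fps_mulC a b n : fps_mul a b n = fps_mul b a n.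
Proof.
rewrite /fps_mul (reindex_inj rev_ord_inj); apply: eq_bigr => i _ /=.
by rewrite subSS subKn -1?ltnS // mulrC.
Qed.

Lemma fps_mulV a n : a 0 != 0 -> fps_mul a (fps_inv a) n = (n == 0)%:R.
Proof.
move=> a0; rewrite fps_mulC /fps_mul big_ord_recr /= subnn [fps_inv a n]fps_invE divfK //.
under eq_bigr do rewrite mulrC.
by rewrite addrC subrK.
Qed.

Lemma degexp0 l : degexp l 0 = 1.
Proof. by rewrite /degexp /gbinom big_ord0 expr0 divr1 mulr1. Qed.

Lemma degexp1 l : l != 0 -> degexp l 1 = 1.
Proof.
by move=> l0; rewrite /degexp /gbinom big_ord1 subr0 expr1 divr1 mulVf.
Qed.

Lemma degBernoulli_genfun l n : l != 0 ->
  fps_mul (fun k => degexp l k - (k == 0)%:R)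
          (fun k => degBernoulli k l / k`!%:R) n = (n == 1)%:R.
Proof.
move=> l0; rewrite /fps_mul big_ord_recl /= degexp0 subrr mul0r add0r.
case: n => [|n]; first by rewrite big_ord0.
rewrite eqSS -(fps_mulV (a := fun i => degexp l i.+1)) ?degexp1 ?oner_eq0 //.
apply: eq_bigr => i _; rewrite /= subr0 subSS /degBernoulli; congr (_ * _).
by rewrite mulrAC divff ?mul1r // pnatr_eq0 -lt0n fact_gt0.
Qed.

Lemma degBernoulli_unique l (b : nat -> F) : l != 0 ->
  (forall n, fps_mul (fun k => degexp l k - (k == 0)%:R)
                     (fun k => b k / k`!%:R) n = (n == 1)%:R) ->
  forall k, b k = degBernoulli k l.
Proof.
move=> l0 bE; elim/ltn_ind => k IHk.
have := bE k.+1; rewrite -(degBernoulli_genfun k.+1 l0) /fps_mul.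
rewrite !(big_ord_recl k.+1) /= degexp0 subrr !mul0r !add0r !big_ord_recl /=.
rewrite degexp1 // subr0 !mul1r subSS subn0.
set s1 := \sum_(i < k) _; set s2 := \sum_(i < k) _.
have -> : s1 = s2.
  apply: eq_bigr => i _; congr (_ * (_ / _)); apply: IHk.
  by rewrite /= !subSS ltn_subrL (leq_ltn_trans _ (ltn_ord i)).
move/addIr/divIf; apply.
by rewrite pnatr_eq0 -lt0n fact_gt0.
Qed.

End FormalPowerSeries.

Section RootOfUnitySums.
Variable R : realType.

Definition cexp (z : R[i]) : R[i] :=
  let: (x +i* y)%C := z in ((expR x * cos y) +i* (expR x * sin y))%C.

Definition zeta (n : nat) : R[i] :=
  cexp (2 * (pi : R)%:C%C * 'i%C / n%:R).

(* The index set is 1 <= i_1 < ... < i_m <= n - 1. *)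
Definition Zsum (n m : nat) (z : R[i]) (s : 'I_m -> nat) : R[i] :=
  \sum_(i : {ffun 'I_m -> 'I_n} |
        [forall k, (1 <= i k)%N] &&
        [forall k : 'I_m, forall l : 'I_m, (k < l)%N ==> (i k < i l)%N])
    \prod_(k < m) (1 / (1 - z ^+ i k) ^+ s k).

End RootOfUnitySums.

(* Main.v *)
Require Import Defs.
From mathcomp Require Import all_boot all_order all_algebra.
From mathcomp Require Import all_classical all_reals all_analysis.
From mathcomp Require Import complex.
From mathcomp Require Import ring.
Set Implicit Arguments.
Unset Strict Implicit.
Unset Printing Implicit Defensive.
Import Order.TTheory GRing.Theory Num.Theory.
Local Open Scope ring_scope.

(* Put x_a = 1 / (1 - zeta^a) for 0 < a < n. The left-hand side is the        *)
(* monomial symmetric function of shape (A, 1^(m-1)) in the x_a. Since        *)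
(* p_r e_m = m_(r+1, 1^(m-1)) + m_(r, 1^m), it is an alternating sum of the   *)
(* products p_(A-1-k) e_(m+k), up to one last multiple of e_(m+A-1).          *)
(* Evaluating \prod_a (1 + x_a X) = ((1 + X)^n - 1) / (n X) gives             *)
(* e_m = 'C(n, m+1) / n. For power sums, 1 / (1 - zeta^a) = 1 + y with        *)
(* y = 1 / (zeta^-a - 1), so that p_(s+1) = \sum_j 'C(s, j) \sum_a x_a y^j,   *)
(* and \sum_a x_a y^j = - n^(j+1) beta_(j+1)(1/n) / (j+1)! because both sides *)
(* satisfy the recurrence expressing that the generating function of the      *)
(* beta's is the inverse of ((1 + t)^n - 1) / (n t).                          *)
(* The index a = 0 is kept in all sums over 'I_n: division by zero makes the  *)
(* corresponding x_0 equal to 0.                                              *)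

(** [sum_Zsum_hookf] turns the left-hand side into a hook monomial sum, and [hookf_expand] writes it
    through p_r and e_l. These are evaluated by [psumf_prim_root] with [degBernoulli_prim_root], and
    by [esymf_prim_root]. The double sum takes the products with k <= A-3. The product at k = A-2
    has p_1 = (n-1)/2 and merges with the last multiple of e_(m+A-1) into the closed term. *)

Section HookSymmetricFunctions.
Variables (F : comNzRingType) (I : finType) (x : I -> F).

Definition esymf (m : nat) : F :=
  \sum_(S : {set I} | #|S| == m) \prod_(i in S) x i.

Definition psumf (r : nat) : F := \sum_i x i ^+ r.

(* The monomial symmetric function of the hook partition (r, 1^(m-1)),        *)
(* except that [hookf 1 m] counts each monomial of [esymf m] m times.         *)
Definition hookf (r m : nat) : F :=
  \sum_(S : {set I} | #|S| == m)
    \sum_(a in S) x a ^+ r * \prod_(i in S :\ a) x i.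

Lemma hookf1 m : hookf 1%N m = m%:R * esymf m.
Proof.
rewrite /hookf /esymf mulr_sumr; apply: eq_bigr => S /eqP Sm.
transitivity (\sum_(a in S) \prod_(i in S) x i).
  by apply: eq_bigr => a aS; rewrite expr1 [RHS](big_setD1 a).
by rewrite sumr_const Sm mulr_natl.
Qed.

(** Multiply x_a^r by the product over S: if a is in S, its exponent rises to r+1; otherwise a
    becomes the marked element of the larger set a |: S. *)
Lemma psumf_esymf r m : psumf r * esymf m = hookf r.+1 m + hookf r m.+1.
Proof.
have -> : psumf r * esymf m =
    \sum_(S : {set I} | #|S| == m) \sum_a x a ^+ r * \prod_(i in S) x i.
  by rewrite mulr_sumr; apply: eq_bigr => S _; rewrite mulr_suml.
under eq_bigr => S _ do rewrite (bigID [in S]) /=.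
rewrite big_split /=; congr (_ + _).
  apply: eq_bigr => S _; apply: eq_bigr => a aS.
  by rewrite (big_setD1 a) //= exprSr mulrA.
rewrite /hookf !pair_big_dep /=.
rewrite [RHS](reindex_onto (fun p : {set I} * I => (p.2 |: p.1, p.2))
                           (fun p => (p.1 :\ p.2, p.2))) /=; last first.
  by case=> S a /= /andP[_ aS]; rewrite finset.setD1K.
apply: eq_big => [[S a] /=|[S a] /= /andP[_ aS]]; last by rewrite finset.setU1K.
rewrite setU11 andbT xpair_eqE eqxx andbT cardsU1.
(* If a is already in S, removing it from a |: S does not give S back, so the reindexing discards
   the pair. *)
have [aS|aS] := boolP (a \in S) => /=.
  rewrite andbF; apply/esym/negbTE; rewrite negb_and; apply/orP; right.
  by apply/eqP => /setP/(_ a); rewrite !inE eqxx aS.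
by rewrite add1n eqSS finset.setU1K // eqxx !andbT.
Qed.

(** Iterating [psumf_esymf] lowers the exponent while lengthening the hook; it stops at [hookf1],
    whose multiplicity gives the factor m+r+1. *)
Lemma hookf_expand r m :
  hookf r.+2 m = \sum_(k < r.+1) (-1) ^+ k * psumf (r.+1 - k) * esymf (m + k)
                 + (-1) ^+ r.+1 * (m + r.+1)%:R * esymf (m + r.+1).
Proof.
have hookE s l : hookf s.+1 l = psumf s * esymf l - hookf s l.+1.
  by rewrite psumf_esymf addrK.
elim: r m => [|r IHr] m.
  by rewrite hookE hookf1 big_ord1 addn0 addn1 expr1 expr0; ring.
rewrite hookE IHr [in RHS]big_ord_recl /= addn0 expr0 mul1r subn0 opprD addrA.
congr (_ + _ + _).
  rewrite -sumrN; apply: eq_bigr => i _ /=.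
  by rewrite subSS addSnnS exprS mulN1r !mulNr.
by rewrite addSnnS [in RHS]exprS mulN1r !mulNr.
Qed.

Lemma coef_prod_1DcX m : (\prod_i (1 + x i *: 'X))`_m = esymf m.
Proof.
under eq_bigr do rewrite addrC.
rewrite bigA_distr coef_sum /esymf [RHS]big_mkcond /=; apply: eq_bigr => S _.
rewrite -big_mkcond /= scaler_prod prodr_const coefZ coefXn eq_sym.
by case: eqP; rewrite ?mulr1 ?mulr0.
Qed.

End HookSymmetricFunctions.

(** * Increasing tuples as subsets *)

Section IncreasingFunctions.
Variables (m n : nat).

Definition increasing (f : {ffun 'I_m -> 'I_n}) : bool :=
  [forall k : 'I_m, forall l : 'I_m, (k < l)%N ==> (f k < f l)%N].

Lemma increasing_inj f : increasing f -> injective f.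
Proof.
move=> /forallP fP k l fkl; apply: val_inj.
by case: (ltngtP k l) => // /(implyP (forallP (fP _) _)); rewrite fkl ltnn.
Qed.

Let lt_ord : rel 'I_n := relpre val ltn.

Let lt_ord_trans : transitive lt_ord.
Proof. by move=> a b c; apply: ltn_trans. Qed.

Let enum_set_sorted (S : {set 'I_n}) : sorted lt_ord (enum S).
Proof.
apply: sorted_filter => //; rewrite -enumT -sorted_map val_enum_ord.
exact: iota_ltn_sorted.
Qed.

(** Both lists are strictly sorted with the same members. Hence an increasing function is determined
    by its image. *)
Lemma increasing_enum (f : {ffun 'I_m -> 'I_n}) :
  increasing f -> enum (f @: [set: 'I_m]) = codom f.
Proof.
move=> f_incr; have lt_irr : irreflexive lt_ord by move=> a; apply: ltnn.
apply: (irr_sorted_eq lt_ord_trans lt_irr) => //.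
- rewrite /codom /image_mem sorted_map.
  have : sorted (relpre val ltn) (enum 'I_m).
    by rewrite -sorted_map val_enum_ord iota_ltn_sorted.
  apply: sub_sorted => k l /= kl.
  by have /forallP/(_ k)/forallP/(_ l)/implyP := f_incr; apply.
- move=> a; rewrite mem_enum; apply/imsetP/codomP => [[k _ ->]|[k ->]].
    by exists k.
  by exists k; rewrite ?inE.
Qed.

Lemma sum_increasing (V : nmodType) (G : {set 'I_n} -> V) :
  \sum_(f | increasing f) G (f @: [set: 'I_m])
  = \sum_(S : {set 'I_n} | #|S| == m) G S.
Proof.
have im_inj : {in increasing &,
    injective (fun f : {ffun 'I_m -> 'I_n} => f @: [set: 'I_m])}.
  move=> f g f_incr g_incr fg; apply/ffunP => k.
  have /eq_in_map : codom f = codom g by rewrite -!increasing_enum // fg.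
  by apply; rewrite mem_enum.
rewrite -(big_imset G im_inj); apply: eq_bigl => S.
apply/imsetP/eqP => [[f f_incr ->]|Sm].
  by rewrite card_imset ?cardsT ?card_ord //; apply: increasing_inj.
(* The preimage of S lists its elements in increasing order. *)
pose f := [ffun k => enum_val (cast_ord (esym Sm) k)].
have f_inj : injective f.
  by move=> k l; rewrite !ffunE => /enum_val_inj/cast_ord_inj.
exists f.
  apply/forallP => k; apply/forallP => l; apply/implyP => kl; rewrite !ffunE.
  have x0 : 'I_n := enum_val (cast_ord (esym Sm) k).
  rewrite !(enum_val_nth x0).
  apply: (sorted_ltn_nth lt_ord_trans) => //=; rewrite ?enum_set_sorted //.
    by rewrite inE -cardE Sm.
  by rewrite inE -cardE Sm.
apply/esym/eqP; rewrite eqEcard card_imset // cardsT card_ord Sm leqnn andbT.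
by apply/fintype.subsetP => _ /imsetP[k _ ->]; rewrite ffunE enum_valP.
Qed.

End IncreasingFunctions.

Lemma sum_bin_exp (R : comNzRingType) (n M : nat) (v : R) : (n < M)%N ->
  \sum_(i < M) 'C(n, i)%:R * v ^+ i = (1 + v) ^+ n.
Proof.
move=> nM; rewrite exprDn (big_ord_widen _
  (fun i => 1 ^+ (n - i) * v ^+ i *+ 'C(n, i)) nM) [RHS]big_mkcond.
apply: eq_bigr => i _; rewrite expr1n mul1r mulr_natl ltnS.
by case: leqP => // ni; rewrite bin_small.
Qed.

(** * Power sums and elementary functions at roots of unity *)

Section PrimitiveRoots.
Variables (F : fieldType) (n : nat).

Lemma prim_root_neq0 (z : F) : n.-primitive_root z -> z != 0.
Proof.
move=> z_prim; apply/eqP => z0; have := prim_expr_order z_prim.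
rewrite z0 expr0n gtn_eqF ?(prim_order_gt0 z_prim) //=.
by move=> /esym/eqP; rewrite oner_eq0.
Qed.

Lemma prim_rootV (z : F) : n.-primitive_root z -> n.-primitive_root z^-1.
Proof.
rewrite /primitive_root_of_unity => /andP[-> /forallP z_prim] /=.
apply/forallP => i; have /eqP <- := z_prim i.
by rewrite !unity_rootE exprVn invr_eq1.
Qed.

(** Only powers w^(a l) with 0 < j <= l <= j+k < n occur, and each geometric sum over a vanishes. *)
Lemma sum_prim_root_exp (w : F) j k : n.-primitive_root w ->
  (0 < j)%N -> (j + k < n)%N ->
  \sum_(a < n) w ^+ (a * j) * (w ^+ a - 1) ^+ k = 0.
Proof.
move=> w_prim; elim: k j => [|k IHk] j j_gt0 jkn.
  under eq_bigr do rewrite expr0 mulr1 mulnC exprM.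
  have wj : w ^+ j - 1 != 0.
    rewrite subr_eq0 -(prim_order_dvd w_prim); apply/negP => /(dvdn_leq j_gt0).
    by rewrite leqNgt -[j]addn0 jkn.
  apply: (mulfI wj); rewrite -subrX1 mulr0 exprAC (prim_expr_order w_prim).
  by rewrite expr1n subrr.
under eq_bigr => a _ do rewrite exprS mulrA mulrBr mulr1 -exprD -mulnSr mulrBl.
have jkn' : (j.+1 + k < n)%N by rewrite addSnnS.
by rewrite sumrB !IHk ?subrr // ltnW.
Qed.

(** For w = zeta^-1 and j > 0 this is the sum of x_a y^(j-1), the term a = 0 being 0. *)
Definition prim_root_sum (w : F) j := \sum_(a < n) w ^+ a * (w ^+ a - 1) ^- j.

Lemma prim_root_sum_rec (w : F) N : n.-primitive_root w -> (0 < N)%N ->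
  \sum_(i < N) 'C(n, i.+1)%:R * prim_root_sum w (N - i) = 'C(n, N.+1)%:R.
Proof.
move=> w_prim N_gt0; have n_gt0 := prim_order_gt0 w_prim.
pose v (a : 'I_n) := w ^+ a - 1.
have v_neq0 (a : 'I_n) : (0 < a)%N -> v a != 0.
  move=> a_gt0; rewrite subr_eq0 -(prim_order_dvd w_prim); apply/negP.
  by move=> /(dvdn_leq a_gt0); rewrite leqNgt ltn_ord.
(* For a != 0 this is (1 + v)^n = 1, split between the exponents below and    *)
(* above N and divided by v^(N+1).                                            *)
have inner (a : 'I_n) : \sum_(i < N) 'C(n, i.+1)%:R * v a ^- (N - i)
    = (if a == Ordinal n_gt0 then 'C(n, N.+1)%:R else 0)
      - \sum_(k < n) 'C(n, N.+1 + k)%:R * v a ^+ k.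
  (* At a = 0 the left side is 0 as v = 0; the extra 'C(n, N+1) cancels the k = 0 term. After
     summation over a it alone survives. *)
  have [->|a_neq0] := eqVneq a (Ordinal n_gt0).
    rewrite /v /= expr0 subrr big1 => [|i _]; last first.
      by rewrite expr0n subn_eq0 leqNgt ltn_ord /= invr0 mulr0.
    rewrite (bigD1 (Ordinal n_gt0)) //= expr0 mulr1 addn0 big1 ?addr0 ?subrr //.
    move=> k k_neq0; rewrite expr0n -[_ == _]/(k == Ordinal n_gt0).
    by rewrite (negbTE k_neq0) mulr0.
  have va : v a != 0 by apply: v_neq0; rewrite lt0n.
  rewrite sub0r; apply/eqP; rewrite -addr_eq0; apply/eqP.
  apply: (mulfI (expf_neq0 N.+1 va)); rewrite mulr0 mulrDr !mulr_sumr.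
  have := @sum_bin_exp _ n (N.+1 + n) (v a) (leq_addl _ _).
  rewrite [1 + _]addrC subrK exprAC (prim_expr_order w_prim) expr1n.
  rewrite big_split_ord big_ord_recl /= bin0 expr0 mulr1 -addrA.
  move=> /(canRL (addKr _)); rewrite addNr => sum0; rewrite -[RHS]sum0.
  congr (_ + _); apply: eq_bigr => i _ /=.
    rewrite mulrCA -expfB ?ltnS ?leq_subr // subSn ?leq_subr //.
    by rewrite subKn // ltnW.
  by rewrite exprD mulrCA.
under eq_bigr => i _ do rewrite mulr_sumr.
rewrite exchange_big /=.
transitivity (\sum_(a < n) w ^+ a
                * \sum_(i < N) 'C(n, i.+1)%:R * v a ^- (N - i)).
  apply: eq_bigr => a _; rewrite mulr_sumr; apply: eq_bigr => i _.
  exact: mulrCA.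
under eq_bigr => a _ do rewrite inner mulrBr.
(* When the binomial is nonzero, N > 0 gives 1+k < n, so [sum_prim_root_exp] applies with j = 1. *)
rewrite sumrB [X in _ - X](_ : _ = 0) ?subr0; last first.
  under eq_bigr => a _ do rewrite mulr_sumr.
  rewrite exchange_big big1 //= => k _.
  under eq_bigr => a _ do rewrite mulrCA.
  rewrite -mulr_sumr; have [nk|kn] := ltnP n (N.+1 + k).
    by rewrite bin_small // mul0r.
  under eq_bigr => a _ do rewrite -[X in w ^+ X]muln1.
  rewrite sum_prim_root_exp ?mulr0 //.
  by apply: leq_trans kn; rewrite -addSn leq_add2r ltnS.
rewrite (bigD1 (Ordinal n_gt0)) //= expr0 mul1r big1 ?addr0 // => a.
by move=> /negbTE ->; rewrite mulr0.
Qed.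

(** One factor x_a stays unexpanded in x_a (1+y)^s: at a = 0, where 1+y = 1 differs from x_0 = 0, it
    makes both sides vanish. *)
Lemma psumf_prim_root (z : F) s : n.-primitive_root z ->
  psumf (fun a : 'I_n => (1 - z ^+ a)^-1) s.+1
  = \sum_(j < s.+1) 'C(s, j)%:R * prim_root_sum z^-1 j.+1.
Proof.
move=> z_prim; under [RHS]eq_bigr => j _ do rewrite mulr_sumr.
rewrite exchange_big /psumf; apply: eq_bigr => a _ /=.
have za : z ^+ a != 0 by rewrite expf_neq0 // (prim_root_neq0 z_prim).
rewrite [z^-1 ^+ a]exprVn; move: (z ^+ a) za => u u_neq0.
have xE : (1 - u)^-1 = u^-1 * (u^-1 - 1)^-1.
  have [->|u1] := eqVneq u 1; first by rewrite invr1 subrr invr0 mulr0.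
  by field; rewrite u_neq0 mulN1r subr_eq0 eq_sym u1.
under eq_bigr => j _ do rewrite -exprVn exprS [u^-1 * _]mulrA -xE mulrCA.
rewrite -mulr_sumr sum_bin_exp // exprS.
have [->|u1] := eqVneq u 1; first by rewrite subrr invr0 !mul0r.
congr (_ * _ ^+ _).
by field; rewrite u_neq0 mulN1r subr_eq0 eq_sym u1.
Qed.

(** Substitute 1+X for X in the factorization of X^n - 1 and divide each factor with a > 0 by 1 -
    z^a. *)
Lemma esymf_prim_root (z : F) m : n.-primitive_root z ->
  n%:R * esymf (fun a : 'I_n => (1 - z ^+ a)^-1) m = 'C(n, m.+1)%:R.
Proof.
case: n => [|n' z_prim]; first by [].
set x := fun a : 'I_n'.+1 => _.
pose c := \prod_(i < n') x (lift ord0 i).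
have x0 : x ord0 = 0 by rewrite /x expr0 subrr invr0.
have polyE : 'X * \prod_i (1 + x i *: 'X) = c *: ((1 + 'X) ^+ n'.+1 - 1).
  have := congr1 (comp_poly (1 + 'X)) (factor_Xn_sub_1 z_prim).
  rewrite rmorph_prod /= big_mkord rmorphB /= comp_Xn_poly comp_polyC.
  move=> <-; rewrite !big_ord_recl /= x0 scale0r addr0 mul1r.
  rewrite comp_polyB comp_polyX comp_polyC [1 + _]addrC addrK.
  rewrite scalerAr /c -scaler_prod; congr (_ * _); apply: eq_bigr => i _.
  rewrite comp_polyB comp_polyX comp_polyC /x lift0; set u := z ^+ i.+1.
  have u1 : 1 - u != 0.
    rewrite subr_eq0 eq_sym -(prim_order_dvd z_prim); apply/negP.
    by move=> /(dvdn_leq (ltn0Sn i)); rewrite ltnS leqNgt ltn_ord.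
  rewrite -addrA -polyCB addrC scalerDr; congr (_ + _).
  by rewrite -mul_polyC -polyCM mulVf.
have coefE k : esymf x k = c * 'C(n'.+1, k.+1)%:R.
  rewrite -coef_prod_1DcX.
  have := congr1 (fun p : {poly F} => p`_k.+1) polyE.
  rewrite /= coefXM /= => ->; rewrite coefZ coefB coef1 subr0; congr (_ * _).
  have nM : (n'.+1 < k.+2 + n'.+1)%N by rewrite !addSn !ltnS ltnW ?leq_addl.
  rewrite -(sum_bin_exp _ nM) coef_sum.
  have kn : (k.+1 < k.+2 + n'.+1)%N by rewrite ltn_addr.
  rewrite (bigD1 (Ordinal kn)) //= mulr_natl coefMn coefXn eqxx big1 ?addr0 //.
  move=> i i_neq; rewrite mulr_natl coefMn coefXn -[_ == _]/(Ordinal kn == i).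
  by rewrite eq_sym (negbTE i_neq) mul0rn.
(* The constant c comes from e_0 = 1. *)
have cE : c * n'.+1%:R = 1.
  rewrite -[n'.+1 in LHS]bin1 -coefE /esymf (big_pred1 finset.set0).
    by rewrite big_set0.
  by move=> S; rewrite /= cards_eq0.
by rewrite coefE mulrA [_ * c]mulrC cE mul1r.
Qed.

End PrimitiveRoots.

(** * Degenerate Bernoulli numbers at 1/n *)

Section DegenerateBernoulli.
Variables (F : numFieldType) (n : nat).

Lemma gbinom_nat k : gbinom (n%:R : F) k = 'C(n, k)%:R.
Proof.
rewrite /gbinom; have -> : \prod_(i < k) (n%:R - i%:R : F) = (n ^_ k)%:R.
  elim: k => [|k IHk]; first by rewrite big_ord0.
  rewrite big_ord_recr IHk ffactnSr natrM /=.
  have [kn|nk] := leqP k n; first by rewrite natrB.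
  by rewrite ffact_small // !mul0r.
by rewrite -bin_ffact natrM mulfK // pnatr_eq0 -lt0n fact_gt0.
Qed.

Lemma degBernoulli_prim_root (w : F) j : n.-primitive_root w ->
  n%:R ^+ j.+1 * degBernoulli j.+1 (n%:R^-1 : F)
  = - (j.+1)`!%:R * prim_root_sum n w j.+1.
Proof.
move=> w_prim; have n_neq0 : n%:R != 0 :> F := prim_root_natf_neq0 w_prim.
(* Candidate for n^k beta_k(1/n) / k!, to be identified by [degBernoulli_unique]; index 0 is set
   apart since beta_0 = 1. *)
pose c k := if k is 0 then 1 else - prim_root_sum n w k.
have c0 : c 0%N = 1 by [].
have cS k : c k.+1 = - prim_root_sum n w k.+1 by [].
clearbody c.
suff <- : c j.+1 * j.+1`!%:R / n%:R ^+ j.+1 = degBernoulli j.+1 (n%:R^-1 : F).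
  by rewrite cS mulrCA mulfV ?expf_neq0 // mulr1 mulrC mulrN mulNr.
apply: (@degBernoulli_unique _ _ (fun k => c k * k`!%:R / n%:R ^+ k)) => [|N].
  by rewrite invr_eq0.
have termE i k : (degexp n%:R^-1 i - (i == 0)%:R)
      * (c k * k`!%:R / n%:R ^+ k / k`!%:R)
    = ('C(n, i)%:R - (i == 0)%:R) * c k * n%:R^-1 ^+ (i + k) :> F.
  have -> : degexp n%:R^-1 i - (i == 0)%:R
      = ('C(n, i)%:R - (i == 0)%:R) * n%:R^-1 ^+ i :> F.
    rewrite /degexp invrK gbinom_nat.
    by case: i => [|i] /=; rewrite ?bin0 ?expr0 ?mulr1 // !subr0.
  have k_neq0 : k`!%:R != 0 :> F by rewrite pnatr_eq0 -lt0n fact_gt0.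
  by rewrite exprD -!exprVn [c k * _ * _]mulrAC mulfK //; ring.
transitivity ((\sum_(i < N.+1) ('C(n, i)%:R - (i == 0 :> nat)%:R) * c (N - i)%N)
              * n%:R^-1 ^+ N).
  rewrite mulr_suml; apply: eq_bigr => i _; have := termE i (N - i)%N.
  by rewrite subnKC // -ltnS.
rewrite big_ord_recl /= bin0 subrr mul0r add0r.
case: N => [|N]; first by rewrite big_ord0 mul0r.
(* The c_0 term contributes the binomial that [prim_root_sum_rec] cancels; the coefficient of t is
   treated separately below. *)
rewrite big_ord_recr /= subnn c0 mulr1 subr0 eqSS.
have -> : \sum_(i < N) ('C(n, bump 0 i)%:R - (bump 0 i == 0 :> nat)%:R)
                      * c (N.+1 - bump 0 i)%N
    = - \sum_(i < N) 'C(n, i.+1)%:R * prim_root_sum n w (N - i).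
  rewrite -sumrN; apply: eq_bigr => i _; rewrite /bump /= subr0 add1n subSS.
  by rewrite -[(N - i)%N](subnSK (ltn_ord i)) cS mulrN.
case: N => [|N]; first by rewrite big_ord0 oppr0 add0r bin1 expr1 mulfV.
by rewrite prim_root_sum_rec // addNr mul0r.
Qed.

End DegenerateBernoulli.

(** * Primitivity of zeta *)

Section Zeta.
Variable R : realType.

Lemma zetaX n k : (0 < n)%N ->
  zeta R n ^+ k
  = (cos (k%:R * (2 * pi / n%:R)) +i* sin (k%:R * (2 * pi / n%:R)))%C.
Proof.
move=> n_gt0.
have zetaE : zeta R n = (cos (2 * pi / n%:R) +i* sin (2 * pi / n%:R))%C.
  rewrite /zeta.
  have -> : 2 * (pi : R)%:C%C * 'i%C / n%:R = (0 +i* (2 * pi / n%:R))%C.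
    rewrite -[n%:R](rmorph_nat (real_complex R)).
    rewrite -[2](rmorph_nat (real_complex R)).
    by rewrite -fmorphV -rmorphM mulrAC -rmorphM /=; simpc.
  by rewrite /cexp expR0 !mul1r.
elim: k => [|k IHk]; first by rewrite mul0r cos0 sin0 expr0.
rewrite exprS IHk zetaE; set t := 2 * pi / _; clearbody t; simpc.
rewrite -[k.+1]add1n natrD mulrDl mul1r cosD sinD.
by congr (_ +i* _)%C; ring.
Qed.

(** An order m < n would give t = m pi / n in (0, pi) with cos(2t) = 1, contradicting sin t > 0. *)
Lemma zeta_prim n : (0 < n)%N -> n.-primitive_root (zeta R n).
Proof.
move=> n_gt0; have n_neq0 : n%:R != 0 :> R by rewrite pnatr_eq0 -lt0n.
have zeta_n : zeta R n ^+ n = 1.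
  rewrite zetaX // mulrCA mulfV // mulr1 mulr_natl.
  by rewrite cos2pi sin2pi.
have [m m_prim mn] := prim_order_exists n_gt0 zeta_n.
suff nm : n = m by rewrite {1}nm.
apply/eqP; rewrite eq_sym eqn_leq dvdn_leq //= leqNgt; apply/negP => lt_mn.
have := prim_expr_order m_prim; rewrite zetaX // => -[cos1 _].
have m_gt0 := prim_order_gt0 m_prim.
set t := m%:R * (pi / n%:R : R).
have : 0 < sin t.
  apply: sin_gt0_pi; rewrite mulr_gt0 ?divr_gt0 ?pi_gt0 ?ltr0n //=.
  by rewrite /t mulrCA gtr_pMr ?pi_gt0 // ltr_pdivrMr ?ltr0n // mul1r ltr_nat.
have : cos (t *+ 2) = 1.
  by rewrite -cos1 /t; congr cos; rewrite -mulr_natl; ring.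
rewrite cos_mulr2n => cos_t sin_t_gt0; have := sin_t_gt0.
suff /eqP -> : sin t == 0 by rewrite ltxx.
rewrite -sqrf_eq0 sin2cos2 subr_eq0.
rewrite -(inj_eq (mulIf (_ : 2 != 0 :> R))) ?pnatr_eq0 //.
by rewrite !mulr_natr -[X in _ == X](subrK 1) cos_t.
Qed.

End Zeta.

(** * Assembling the identity *)

Lemma sum_Zsum_hookf (R : realType) (n m A : nat) (z : R[i]) : (0 < A)%N ->
  \sum_(j < m) Zsum n z (fun i : 'I_m => if i == j then A else 1%N)
  = hookf (fun a : 'I_n => (1 - z ^+ a)^-1) A m.
Proof.
move=> A_gt0; set x := fun a : 'I_n => _.
rewrite /hookf -sum_increasing /Zsum exchange_big /= big_mkcondl /=.
apply: eq_bigr => f f_incr; have f_inj := increasing_inj f_incr.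
have -> : \sum_(a in f @: [set: 'I_m])
      x a ^+ A * \prod_(i in f @: [set: 'I_m] :\ a) x i
    = \sum_(j < m) \prod_(k < m) x (f k) ^+ (if k == j then A else 1%N).
  rewrite big_imset /=; last by move=> k l _ _; apply: f_inj.
  rewrite (eq_bigl xpredT) => [|j]; last by rewrite inE.
  apply: eq_bigr => j _.
  rewrite (bigD1 j) //= eqxx; congr (_ * _).
  under eq_bigl do rewrite in_setD1 andbC.
  rewrite big_imset_cond /=; last by move=> k l _ _; apply: f_inj.
  apply: eq_big => [k|k]; last first.
    by rewrite inE (inj_eq f_inj) /= => /negbTE ->; rewrite expr1.
  by rewrite inE (inj_eq f_inj).
(* Tuples hitting index 0 are absent from [Zsum], and add nothing to [hookf] because x_0 = 0 and all
   exponents are positive. *)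
case: ifPn => [_|]; last first.
  case/forallPn => k; rewrite lt0n negbK => /eqP fk0.
  rewrite big1 // => j _; rewrite (bigD1 k) //= /x fk0 expr0 subrr invr0 expr0n.
  by case: ifP => _; rewrite ?mul0r // gtn_eqF // mul0r.
by apply: eq_bigr => j _; apply: eq_bigr => k _; rewrite /x exprVn div1r.
Qed.

Theorem theorem2 (R : realType) (n m A : nat)
    (n_gt0 : (0 < n)%N) (m_gt0 : (0 < m)%N) (A_ge2 : (2 <= A)%N) :
  \sum_(j < m) Zsum n (zeta R n) (fun i : 'I_m => if i == j then A else 1%N)
  = \sum_(0 <= k < A - 2) \sum_(1 <= j < A - k)
      (-1) ^+ k.+1 * n%:R ^+ j * degBernoulli j (n%:R^-1 : R[i])
        / ((m + k + 1)%:R * j`!%:R)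
        * 'C(n - 1, m + k)%:R * 'C(A - k - 2, j - 1)%:R
    + (-1) ^+ (A + 1)
        * ((m + A - 2)%:R * (n%:R - 2 * m%:R - 2 * A%:R + 1)
           / (2 * (m + A - 1)%:R * (m + A)%:R))
        * 'C(n - 1, m + A - 2)%:R.
Proof.
have z_prim := zeta_prim R n_gt0; have w_prim := prim_rootV z_prim.
case: A A_ge2 => [|[|r]] // _.
rewrite sum_Zsum_hookf //; set x := fun a : 'I_n => _; set w := _^-1 in w_prim.
have n_neq0 : n%:R != 0 :> R[i] := prim_root_natf_neq0 z_prim.
have esymE l : esymf x l = 'C(n - 1, l)%:R / l.+1%:R.
  apply: (mulfI n_neq0); rewrite esymf_prim_root //.
  apply: (mulIf (_ : l.+1%:R != 0)).
    by rewrite pnatr_eq0.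
  by rewrite mulrA mulfVK ?pnatr_eq0 // mulrC -!natrM -mul_bin_diag subn1.
(* With A = r+2, the summand k = r is split off to join the closed term. *)
rewrite hookf_expand big_ord_recr /= !subSS !subn0 big_mkord -addrA.
congr (_ + _).
  apply: eq_bigr => k _; rewrite big_add1.
  have kr : (k <= r)%N := ltnW (ltn_ord k).
  have -> : (r.+2 - k).-1 = (r - k).+1 by rewrite !subSn // leqW.
  rewrite big_mkord subSn // psumf_prim_root // esymE mulr_sumr mulr_suml.
  apply: eq_bigr => j _.
  rewrite -[_ * n%:R ^+ _ * _]mulrA (degBernoulli_prim_root j w_prim).
  rewrite addn1 -subnDA addn2 !subSS subn0.
  have fact_neq0 : (j.+1)`!%:R != 0 :> R[i] by rewrite pnatr_eq0 -lt0n fact_gt0.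
  have mk_neq0 : (m + k).+1%:R != 0 :> R[i] by rewrite pnatr_eq0.
  move: (j.+1)`!%:R fact_neq0 (m + k).+1%:R mk_neq0 => c c_neq0 d d_neq0.
  by rewrite -/w exprS; field; apply/andP.
rewrite subSnn psumf_prim_root // big_ord1 bin0 mul1r -/w.
(* The recurrence at N = 1 reads n p_1 = 'C(n, 2). *)
have -> : prim_root_sum n w 1 = (n%:R - 1) / 2.
  apply: (mulfI n_neq0); have := prim_root_sum_rec w_prim (ltn0Sn 0).
  rewrite big_ord1 bin1 => ->.
  apply: (mulIf (_ : 2 != 0)); first by rewrite pnatr_eq0.
  rewrite mulrA mulfVK ?pnatr_eq0 // -natrM mulnC -mul_bin_diag bin1 natrM.
  by rewrite -subn1 natrB.
(* Reduces the closed term to a single binomial, leaving a rational identity. *)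
have binS l : 'C(n - 1, l.+1)%:R
    = (n%:R - 1 - l%:R) * 'C(n - 1, l)%:R / l.+1%:R :> R[i].
  apply: (mulIf (_ : l.+1%:R != 0)); first by rewrite pnatr_eq0.
  rewrite mulfVK ?pnatr_eq0 // mulrC -natrM mul_bin_left natrM.
  have [ln|nl] := leqP l (n - 1); first by rewrite !natrB.
  by rewrite bin_small // !mulr0.
rewrite !esymE !addnS !subSS !subn0 binS addn0.
move: 'C(_, _)%:R => b; rewrite !exprS.
by field; rewrite -!natrD nat1r !pnatr_eq0.
Qed.
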